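(* Let $0\le a<b$ and let $X,X_1,X_2,\dots$ be i.i.d. $[a,b]$-valued random variables with $\mathrm{P}(X=0)<1$. Then for all $t>0$, $$M(t;X)-V(t;X)\le \min\left\{(b-a)\beta(t),\ \frac{b\,\beta(t)\,(1-e^{-t})}{\beta(t)+1-e^{-t}}\right\},$$ where $\gamma(t):=t/(1-e^{-t})$ and $\beta(t):=1-\{1+\log\gamma(t)\}/\gamma(t)$.
   Context: Let $S_1<S_2<\cdots$ be the arrival times of a homogeneous Poisson process with rate $\lambda=1$ on $(0,\infty)$, independent of the sequence $X_1,X_2,\dots$; the value $X_k$ is observed at time $S_k$. Let $N(t)$ be the number of arrivals up to time $t$, i.e. $N(t)=\max\{k\ge 0: S_k\le t\}$ with $S_0=0$. Define $$M(t;X):=\mathrm{E}\big(\max\{X_1,\dots,X_{N(t)}\}\big),$$ where the maximum of an empty set is taken to be $0$, and $$V(t;X):=\sup_{\tau\in\mathcal{T}}\mathrm{E}\big[X_\tau\,\mathrm{I}(S_\tau\le t)\big],$$ where $\mathrm{I}$ denotes an indicator and $\mathcal{T}$ is the set of all $\mathbb{N}$-valued random variables (stopping rules) $\tau$ such that, for each $i$, the event $\{\tau=i\}$ is measurable with respect to the $\sigma$-algebra generated by $(X_1,S_1),\dots,(X_i,S_i)$. Both quantities depend on the common law of the $X_k$ (that of $X$), as the notation indicates. *)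

(* Defs.v *)
From HB Require Import structures.
From mathcomp Require Import all_boot all_order all_algebra finmap.
From mathcomp Require Import all_classical all_reals all_analysis.

Set Implicit Arguments.
Unset Strict Implicit.
Unset Printing Implicit Defensive.

Import Order.TTheory GRing.Theory Num.Theory.
Import numFieldNormedType.Exports.

Local Open Scope classical_set_scope.
Local Open Scope ring_scope.

(* Families are indexed by [nat]; a set [D] of indices selects the relevant
   members, e.g. [set k | (1 <= k)%N] for sequences starting at index 1. *)

Section independence.
Context d (T : measurableType d) (R : realType) (P : probability T R).

Definition family_sigma d' (U : measurableType d') (D : set nat)
    (Y : nat -> T -> U) : set (set T) :=
  <<s \bigcup_(k in D) preimage_set_system setT (Y k) measurable >>.

Definition indep_systems (F G : set (set T)) : Prop :=
  forall A B, F A -> G B -> P (A `&` B) = (P A * P B)%E.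

Definition mutually_independent d' (U : measurableType d') (D : set nat)
    (Y : nat -> T -> U) : Prop :=
  forall (J : {fset nat}) (B : nat -> set U),
    [set` J] `<=` D -> (forall k, measurable (B k)) ->
    P (\bigcap_(k in [set` J]) Y k @^-1` B k) =
    (\prod_(k <- J) P (Y k @^-1` B k))%E.

End independence.

Section optimal_stopping.
Context d (T : measurableType d) (R : realType) (P : probability T R).
Implicit Types (X S : nat -> {RV P >-> R}) (t : R).

(* The arrivals are [S 1], [S 2], ...; [S 0] is the time origin. *)
Definition poisson_arrivals (rate : R) S : Prop :=
  [/\ forall w, S 0%N w = 0,
      mutually_independent P setT (fun k w => S k.+1 w - S k w) &
      forall k (B : set R), measurable B ->
        P ((fun w => S k.+1 w - S k w) @^-1` B) = exponential_prob rate B].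

(* The largest [k] with [S k w <= t]; the default 0 is only relevant when there
   is no largest [k], a null event for Poisson arrivals and [0 <= t]. *)
Definition arrival_count S t (w : T) : nat :=
  xget 0%N [set n | S n w <= t /\ forall k, S k w <= t -> (k <= n)%N].

Definition max_upto X (n : nat) (w : T) : R :=
  if n is 0 then 0 else \big[Num.max/X 1%N w]_(1 <= k < n.+1) X k w.

Definition prophet_value X S t : \bar R :=
  ('E_P[fun w => max_upto X (arrival_count S t w) w])%E.

Definition stopping_rule X S (tau : T -> nat) : Prop :=
  (forall w, (1 <= tau w)%N) /\
  forall i, (1 <= i)%N ->
    family_sigma [set k | (1 <= k <= i)%N] (fun k w => (X k w, S k w))
      (tau @^-1` [set i]).

Definition stopping_value X S t : \bar R :=
  ereal_sup
    [set ('E_P[fun w => (X (tau w) w * \1_[set v | S (tau v) v <= t] w)%R])%E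
    | tau in stopping_rule X S].

End optimal_stopping.

Section bound.
Context (R : realType).

Definition gamma (t : R) : R := t / (1 - expR (- t)).

Definition beta (t : R) : R := 1 - (1 + ln (gamma t)) / gamma t.

End bound.

(* Main.v *)
Require Import Defs.
From HB Require Import structures.
From mathcomp Require Import all_boot all_order all_algebra finmap.
From mathcomp Require Import all_classical all_reals all_analysis.
From mathcomp Require Import measurable_realfun ring lra.

Set Implicit Arguments.
Unset Strict Implicit.
Unset Printing Implicit Defensive.

Import Order.TTheory GRing.Theory Num.Theory.
Import numFieldNormedType.Exports.

Local Open Scope classical_set_scope.
Local Open Scope ring_scope.

(* Idea. Write p = 1 - e^-t, G(y) = P(X > y), g = P(X >= x) and
   q = 1 - e^(-t g). By thinning, some observation exceeding y arrives before t
   with probability 1 - e^(-t G(y)), so M(t) is the integral of this over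
   y in [0, b]. The rule "stop at the first observation >= x" earns q / g times
   the integral of P(X >= x, X > y). For y < x the two integrands differ by at
   most p - q. For y >= x put r = G(y) / g; since
     (1 - e^(-t g r)) / q <= (1 - e^(-t r)) / p <= r + beta(t) / p
   they differ by at most q beta(t) / p. Hence
     M - V <= (p - q) x + q (beta(t) / p) (b - x).
   The choice x = a gives q = p and the first bound; the choice
   x = b beta(t) / (beta(t) + p) makes the right-hand side equal to p x, whatever
   q is, and gives the second one. *)

(** * Real inequalities *)

Section real_inequalities.
Context {R : realType}.
Implicit Types t c r s g y : R.

Lemma one_sub_expRN_gt0 t : 0 < t -> 0 < 1 - expR (- t).
Proof. by move=> t0; rewrite subr_gt0 expR_lt1 oppr_lt0. Qed.

Lemma one_sub_expRN_ge0 t : 0 <= t -> 0 <= 1 - expR (- t).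
Proof. by move=> t0; rewrite subr_ge0 expR_le1 oppr_le0. Qed.

(** Convexity of the exponential: the tangent at [r] stays below the graph. *)
Lemma expR_subtangent s r : expR r * (1 + (s - r)) <= expR s.
Proof.
have -> : expR s = expR r * expR (s - r) by rewrite -expRD addrC subrK.
by rewrite ler_wpM2l ?expR_ge0 ?expR_ge1Dx.
Qed.

(* The maximum over [r] of the left-hand side is attained at
   [r = ln (gamma t) / t]. *)
Lemma le_beta t r : 0 < t ->
  1 - expR (- (t * r)) - r * (1 - expR (- t)) <= beta t.
Proof.
move=> t0; have p0 := one_sub_expRN_gt0 t0.
rewrite /beta; set z := ln (gamma t).
have g0 : 0 < gamma t by rewrite divr_gt0.
have ez : (gamma t)^-1 = expR (- z) by rewrite expRN lnK.
have trz : r * (1 - expR (- t)) = t * r / gamma t.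
  by rewrite /gamma invf_div; field; rewrite !gt_eqF.
rewrite trz ez.
(* The tangent is taken at [- z], where the exponential equals [(gamma t)^-1], the slope of the
   linear term. *)
by have := expR_subtangent (- (t * r)) (- z); lra.
Qed.

Lemma beta_ge0 t : 0 < t -> 0 <= beta t.
Proof.
by move=> t0; have := @le_beta t 0 t0; rewrite mulr0 oppr0 expR0 mul0r !subrr.
Qed.

(** The tangent at [r * s], evaluated at 0 and at [s], is averaged with weights [1 - r] and [r]; the
    linear terms cancel. *)
Lemma expR_le_chord r s : 0 <= r <= 1 -> expR (r * s) <= 1 - r + r * expR s.
Proof.
move=> /andP[r0 r1].
have := expR_subtangent 0 (r * s); have := expR_subtangent s (r * s).
rewrite expR0; nra.
Qed.

(** Division by [expR (- (c * r))] turns the claim, with [U = expR (- c)] and [W = expR (- t)], into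
    [(1 - U) * expR (r * (c - t)) + (U - W) * expR (r * c) <= 1 - W]. The left-hand side is convex
    in [r] and equals [1 - W] at both [r = 0] and [r = 1]. *)
Lemma one_sub_expRN_ratio c t r : 0 <= c <= t -> 0 <= r <= 1 ->
  (1 - expR (- (c * r))) * (1 - expR (- t)) <=
  (1 - expR (- (t * r))) * (1 - expR (- c)).
Proof.
move=> /andP[c0 ct] r01.
have e1 : expR (- (t * r)) = expR (- (c * r)) * expR (r * (c - t)).
  by rewrite -expRD; congr expR; ring.
have e2 : expR (- (c * r)) * expR (r * c) = 1.
  by rewrite -expRD -expR0; congr expR; ring.
have e3 : expR (- t) = expR (- c) * expR (c - t).
  by rewrite -expRD; congr expR; ring.
have e4 : expR (- c) * expR c = 1.
  by rewrite -expRD -expR0; congr expR; ring.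
have A0 := expR_ge0 (- (c * r)).
have U1 : expR (- c) <= 1 by rewrite expR_le1 oppr_le0.
have WU : expR (- t) <= expR (- c) by rewrite ler_expR lerN2.
have U0 := expR_ge0 (- c).
have := expR_le_chord (c - t) r01; have := expR_le_chord c r01.
rewrite e1.
set A := expR (- (c * r)) in e2 A0 *; set B := expR (r * c) in e2 *.
set W := expR (- t) in e3 WU *; set U := expR (- c) in e3 e4 U0 U1 WU *.
set D := expR (c - t) in e3 *; set F := expR c in e4 *.
set E := expR (r * (c - t)).
move=> hB hE.
have h1 : A * E <= A * (1 - r + r * D) by exact: ler_wpM2l.
have h2 : A * B <= A * (1 - r + r * F) by exact: ler_wpM2l.
rewrite e2 in h2.
have h3 : (1 - U) * (A * E) <= (1 - U) * (A * (1 - r + r * D)).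
  by apply: ler_wpM2l => //; rewrite subr_ge0.
have h4 : (U - W) * 1 <= (U - W) * (A * (1 - r + r * F)).
  by apply: ler_wpM2l => //; rewrite subr_ge0.
(* The combination of the two chords is constant in [r], because [W = U * D] and [U * F = 1]. *)
have h5 : (1 - U) * (1 - r + r * D) + (U - W) * (1 - r + r * F) = 1 - W.
  rewrite e3.
  transitivity (1 - r + r * (D - U * D + (U * F) * (1 - D)) - U * D * (1 - r)).
    ring.
  by rewrite e4; ring.
have h6 : (1 - U) * (A * (1 - r + r * D)) + (U - W) * (A * (1 - r + r * F)) =
   A * (1 - W) by rewrite -h5; ring.
by lra.
Qed.

(** With [r = y / g], the ratio inequality at [c = t * g] passes from [t * g] to [t], and [le_beta]
    then bounds what remains linearly in [r]. *)
Lemma one_sub_expRN_le_beta t g y : 0 < t -> 0 <= y -> y <= g -> g <= 1 ->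
  1 - expR (- (t * y)) <=
  (1 - expR (- (t * g))) / g * y +
  (1 - expR (- (t * g))) * (beta t / (1 - expR (- t))).
Proof.
move=> t0 y0 yg g1.
have p0 := one_sub_expRN_gt0 t0; have b0 := beta_ge0 t0.
have [g0|gn0] := leP g 0.
  have -> : y = 0 by apply/eqP; rewrite eq_le y0 (le_trans yg).
  have -> : g = 0 by apply/eqP; rewrite eq_le g0 (le_trans y0).
  by rewrite !mulr0 oppr0 expR0 subrr mul0r addr0.
have tg0 : 0 <= t * g by rewrite mulr_ge0 // ltW.
have tgt : 0 <= t * g <= t by rewrite tg0 ger_pMr.
have r01 : 0 <= y / g <= 1 by rewrite divr_ge0 ?(ltW gn0)//= ler_pdivrMr ?mul1r.
have := one_sub_expRN_ratio tgt r01.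
have -> : t * g * (y / g) = t * y by field; rewrite gt_eqF.
rewrite -ler_pdivlMr// => /le_trans; apply.
rewrite ler_pdivrMr//.
have q0 : 0 <= 1 - expR (- (t * g)) by rewrite one_sub_expRN_ge0.
have := ler_wpM2l q0 (le_beta (y / g) t0).
set Q := 1 - expR (- (t * g)) in q0 *; set p := 1 - expR (- t) in p0 *.
have -> : (Q / g * y + Q * (beta t / p)) * p = Q * (y / g * p + beta t).
  by field; rewrite !gt_eqF.
by lra.
Qed.

End real_inequalities.

(** * Partial sums of the exponential series and Erlang distribution functions *)

Section exponential_partial_sums.
Context {R : realType}.
Implicit Types (t x : R) (n : nat).

(** Multiplied by [expR (- t)], this is the probability that a Poisson variable of mean [t] is
    smaller than [n], that is, that the [n]-th arrival comes after time [t]. *)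
Definition exp_sum n t : R := \sum_(j < n) t ^+ j / j`!%:R.

Lemma exp_sumE t : exp_sum ^~ t = series (exp_coeff t).
Proof. by apply/funext => n; rewrite /exp_sum /series/= big_mkord. Qed.

Lemma exp_sum0 n : exp_sum n.+1 0 = 1 :> R.
Proof.
have /(congr1 (@^~ n.+1)) /= -> := exp_sumE (0 : R).
by rewrite series_exp_coeff0.
Qed.

Lemma exp_sumS n t : exp_sum n.+1 t = exp_sum n t + t ^+ n / n`!%:R.
Proof. by rewrite /exp_sum big_ord_recr. Qed.

Lemma cvg_exp_sum t : exp_sum n t @[n --> \oo] --> expR t.
Proof. rewrite exp_sumE; exact: is_cvg_series_exp_coeff. Qed.

Lemma is_derive_exp_sum n t :
  is_derive t (1 : R) (exp_sum n.+1 : R -> R) (exp_sum n t).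
Proof.
elim: n => [|n IH].
  rewrite [exp_sum 0 t]/exp_sum big_ord0 (_ : exp_sum 1 = cst 1).
    exact: is_derive_cst.
  by apply/funext => x; rewrite /exp_sum big_ord_recl big_ord0 expr0 divr1 addr0.
rewrite (_ : exp_sum n.+2 =
    exp_sum n.+1 + ((n.+1`!%:R)^-1 \*: (@id R ^+ n.+1))).
  apply: is_derive_eq.
  rewrite exp_sumS factS natrM/= scaler1 /GRing.scale/=.
  have n0 : n`!%:R != 0 :> R by rewrite pnatr_eq0 -lt0n fact_gt0.
  have n1 : n.+1%:R != 0 :> R by rewrite pnatr_eq0.
  by field; rewrite n0 nat1r.
apply/funext => x; rewrite exp_sumS; congr (_ + _).
by rewrite /GRing.scale/= mulrC exprfctE.
Qed.

Lemma derivable_exp_sum n t : derivable (exp_sum n : R -> R) t 1.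
Proof.
case: n => [|n]; last by have [] := is_derive_exp_sum n t.
rewrite (_ : exp_sum 0 = cst 0); first exact: derivable_cst.
by apply/funext => x; rewrite /exp_sum big_ord0.
Qed.

(** Convolving the exponential density with the Erlang distribution function of order [n] gives that
    of order [n.+1]; this is the induction step of [arrival_cdf]. *)
Lemma integral_expR_exp_sum n t : 0 < t ->
  (\int[lebesgue_measure]_(s in `[0%R, t])
     (expR (- s) * (1 - expR (- (t - s)) * exp_sum n (t - s))%R)%:E =
   (1 - expR (- t) * exp_sum n.+1 t)%:E)%E.
Proof.
move=> t0.
(* The integrand simplifies to [f], since [expR (- s) * expR (- (t - s)) = expR (- t)]; [F] is an
   antiderivative because differentiating [exp_sum n.+1] gives [exp_sum n]. *)
pose F s := - expR (- s) + expR (- t) * exp_sum n.+1 (t - s).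
pose f s := expR (- s) - expR (- t) * exp_sum n (t - s).
have dsub s : is_derive s (1 : R) (fun s : R => t - s) (- 1 : R).
  by apply: is_derive_eq; rewrite add0r mul1r.
have dexpN s : is_derive s (1 : R) (fun s : R => expR (- s)) (- expR (- s)).
  by apply: is_derive_eq; rewrite mulrN1.
have dF s : is_derive s (1 : R) (F : R -> R) (f s).
  have dC := @is_derive1_comp _ (exp_sum n.+1) (fun s => t - s) s _ _
    (is_derive_exp_sum n (t - s)) (dsub s).
  have -> : F = - (fun s => expR (- s)) +
      expR (- t) \*: (exp_sum n.+1 \o (fun s => t - s)).
    by [].
  by apply: is_derive_eq; rewrite opprK mulrN1 /GRing.scale/= mulrN.
have df s : derivable (f : R -> R) s 1.
  have dC : derivable (exp_sum n \o (fun s => t - s)) s 1.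
    apply/derivable1_diffP/differentiable_comp.
      by apply/derivable1_diffP; have [] := dsub s.
    exact/derivable1_diffP/derivable_exp_sum.
  have -> : f = (fun s => expR (- s)) -
      expR (- t) \*: (exp_sum n \o (fun s => t - s)).
    by [].
  apply: derivableB; first by have [] := dexpN s.
  exact: derivableZ.
under eq_integral do rewrite mulrBr mulr1 mulrA -expRD opprB addKr.
rewrite (@continuous_FTC2 _ f F)//.
- rewrite -EFinB /F subrr exp_sum0 subr0 oppr0 expR0; congr EFin; ring.
- by apply: derivable_within_continuous => s _; exact: df.
- have cF : continuous F.
    by move=> s; apply/differentiable_continuous/derivable1_diffP; have [] := dF s.
  split.
  + by move=> s _; have [] := dF s.
  + exact/cvg_at_right_filter/cF.
  + exact/cvg_at_left_filter/cF.
- by move=> s _; rewrite derive1E; have [_ ->] := dF s.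
Qed.

End exponential_partial_sums.

(** * Thinning: the first success among the arrivals up to time [t] *)

Section geometric_thinning.
Context {R : realType}.
Implicit Types (t g : R) (n : nat).

Lemma exp_sum_le_expR n t : 0 <= t -> exp_sum n t <= expR t.
Proof.
move=> t0; rewrite -(cvg_lim (@Rhausdorff R) (@cvg_exp_sum _ t)).
apply: (@nondecreasing_cvgn_le _ (exp_sum ^~ t)).
  apply/nondecreasing_seqP => m; rewrite exp_sumS lerDl.
  by rewrite divr_ge0// exprn_ge0.
by apply/cvg_ex; exists (expR t); exact: cvg_exp_sum.
Qed.

Lemma one_sub_exp_sum_ge0 n t : 0 <= t -> 0 <= 1 - expR (- t) * exp_sum n t.
Proof.
move=> t0; rewrite subr_ge0 expRN ler_pdivrMl ?expR_gt0// mulr1.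
exact: exp_sum_le_expR.
Qed.

(** If each arrival succeeds with probability [g], then [g * thinning n g t] is the probability that
    the first success is one of the first [n] arrivals and comes by time [t]. The factor [g] is left
    out so that the probability of a smaller event at that arrival can replace it. *)
Definition thinning n g t : R :=
  \sum_(k < n) (1 - expR (- t) * exp_sum k.+1 t) * (1 - g) ^+ k.

Lemma thinning_ge0 n g t : 0 <= t -> g <= 1 -> 0 <= thinning n g t.
Proof.
move=> t0 g1; apply: sumr_ge0 => k _.
by rewrite mulr_ge0 ?one_sub_exp_sum_ge0 ?exprn_ge0// subr_ge0.
Qed.

(** Summation by parts against the powers of [1 - g]; as [n] grows, the first partial sum tends to
    [expR ((1 - g) * t)] and the last term vanishes. *)
Lemma thinningE n g t : g * thinning n g t =
  1 - expR (- t) * exp_sum n ((1 - g) * t) -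
  (1 - g) ^+ n * (1 - expR (- t) * exp_sum n t).
Proof.
elim: n => [|n IH]; first by rewrite /thinning /exp_sum !big_ord0; ring.
rewrite /thinning big_ord_recr/= mulrDr -/(thinning n g t) IH.
by rewrite !exp_sumS exprS exprMn; ring.
Qed.

Lemma cvg_thinning g t : 0 <= g <= 1 ->
  g * thinning n g t @[n --> \oo] --> 1 - expR (- (t * g)).
Proof.
move=> /andP[g0 g1].
under eq_cvg do rewrite thinningE.
have -> : 1 - expR (- (t * g)) = 1 - expR (- t) * expR ((1 - g) * t) - 0.
  by rewrite -expRD subr0; congr (1 - expR _); ring.
have cu : (1 - expR (- t) * exp_sum n t) @[n --> \oo] --> (0 : R).
  have -> : 0 = 1 - expR (- t) * expR t :> R by rewrite -expRD addNr expR0 subrr.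
  by apply: cvgB; [exact: cvg_cst|apply: cvgMr; exact: cvg_exp_sum].
apply: cvgB.
  by apply: cvgB; [exact: cvg_cst|apply: cvgMr; exact: cvg_exp_sum].
(* The power of [1 - g] is only bounded by 1, as [g] may be 0; the other factor is what tends to
   0. *)
apply: (@squeeze_cvgr _ _ _ _ (fun n => - `|1 - expR (- t) * exp_sum n t|)
   (fun n => `|1 - expR (- t) * exp_sum n t|)).
- near=> n; rewrite -ler_norml normrM ler_piMl//.
  by rewrite normrX exprn_ile1// ger0_norm ?subr_ge0// gerBl.
- by rewrite -oppr0 -(normr0 R); apply: cvgN; apply: cvg_norm.
- by rewrite -(normr0 R); apply: cvg_norm.
Unshelve. all: by end_near. Qed.

Lemma thinning_le n g t : 0 <= t -> 0 <= g <= 1 ->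
  g * thinning n g t <= 1 - expR (- (t * g)).
Proof.
move=> t0 g01; have /andP[g0 g1] := g01.
rewrite -(cvg_lim (@Rhausdorff R) (@cvg_thinning g t g01)).
apply: (@nondecreasing_cvgn_le _ (fun n => g * thinning n g t)).
  apply/nondecreasing_seqP => m; rewrite /thinning big_ord_recr/=.
  rewrite ler_wpM2l// lerDl mulr_ge0 ?one_sub_exp_sum_ge0//.
  by rewrite exprn_ge0// subr_ge0.
by apply/cvg_ex; eexists; exact: cvg_thinning.
Qed.

End geometric_thinning.

(** * Law of the arrival times *)

Section independence_extension.
Local Open Scope ereal_scope.
Context d (T : measurableType d) (R : realType) (P : probability T R).

(** The sets [A] satisfying the product formula form a Dynkin system, so the formula extends from
    the pi-system [G] to the sigma-algebra it generates. *)
Lemma indep_event_preimage d' (U : measurableType d') (G : set (set U))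
    (f : T -> U) (C : set T) :
  measurable_fun setT f -> measurable C -> @measurable _ U = <<s G >> ->
  setI_closed G ->
  (forall A, G A -> P (f @^-1` A `&` C) = P (f @^-1` A) * P C) ->
  forall A, measurable A -> P (f @^-1` A `&` C) = P (f @^-1` A) * P C.
Proof.
move=> mf mC GE GI GP A; rewrite GE.
have mpre B : measurable B -> measurable (f @^-1` B).
  by move=> mB; rewrite -[X in measurable X]setTI; exact: mf.
apply: (dynkin_induction
  (P := fun A => P (f @^-1` A `&` C) = P (f @^-1` A) * P C) GE GI) => //.
- by rewrite preimage_setT setTI probability_setT mul1e.
- move=> B mB PB.
  rewrite preimage_setC probability_setC; last exact: mpre.
  rewrite muleBl ?fin_num_measure ?fin_num_adde_defr//.
  have mpB := mpre _ mB.
  have PC : P C < +oo by rewrite ltey_eq fin_num_measure.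
  by rewrite mul1e -PB setIC -setDE measureD// setIC.
- move=> F mF tF PF.
  have tF' : trivIset setT (fun n => f @^-1` F n).
    by move=> i j _ _ [w [Fi Fj]]; apply: tF => //; exists (f w).
  have Pc : P C = (fine (P C))%:E by rewrite fineK ?fin_num_measure.
  rewrite preimage_bigcup setI_bigcupl !measure_bigcup//=.
  + rewrite muleC Pc -nneseriesZl//; apply: eq_eseriesr => i _.
    by rewrite PF muleC -Pc.
  + by move=> i _; exact: mpre.
  + by move=> i _; apply: measurableI => //; exact: mpre.
  + by apply: trivIset_setIr.
Qed.

(** Measurable rectangles are a generating pi-system of the product. This yields independence of [C]
    from any measurable function of the pair, such as a sum. *)
Lemma indep_event_preimage_pair d1 d2 (U1 : measurableType d1)
    (U2 : measurableType d2) (f : T -> U1) (g : T -> U2) (C : set T) :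
  measurable_fun setT f -> measurable_fun setT g -> measurable C ->
  (forall A B, measurable A -> measurable B ->
    P (f @^-1` A `&` g @^-1` B `&` C) = P (f @^-1` A `&` g @^-1` B) * P C) ->
  forall A : set (U1 * U2), measurable A ->
  let fg w := (f w, g w) in
  P (fg @^-1` A `&` C) = P (fg @^-1` A) * P C.
Proof.
move=> mf mg mC fgC A mA fg.
apply: (@indep_event_preimage _ _ [set A `*` B | A in measurable & B in measurable]).
- exact: measurable_fun_pair.
- by [].
- exact: measurable_prod_measurableType.
- move=> /= _ _ [X1 mX1 [X2 mX2 <-]] [Y1 mY1 [Y2 mY2 <-]].
  rewrite -setXI; exists (X1 `&` Y1); first exact: measurableI.
  by exists (X2 `&` Y2) => //; exact: measurableI.
- by move=> _ [X1 mX1 [X2 mX2 <-]]; exact: fgC.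
- by [].
Qed.

End independence_extension.

Section interarrival.
Context d (T : measurableType d) (R : realType) (P : probability T R).
Context (S : nat -> {RV P >-> R}).

Definition interarrival k (w : T) : R := S k.+1 w - S k w.

Let measurable_interarrival k : measurable_fun setT (interarrival k).
Proof. exact: measurable_funB. Qed.

HB.instance Definition _ k :=
  isMeasurableFun.Build _ _ _ _ (interarrival k) (measurable_interarrival k).

End interarrival.

Section poisson_arrivals_theory.
Local Open Scope ereal_scope.
Context d (T : measurableType d) (R : realType) (P : probability T R).
Context (S : nat -> {RV P >-> R}).
Hypothesis S_poisson : poisson_arrivals 1 S.

Let gap k : {RV P >-> R} := interarrival S k.

Let S0 w : S 0%N w = 0%R. Proof. by case: S_poisson. Qed.

Let gap_indep : mutually_independent P setT gap.
Proof. by case: S_poisson. Qed.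

Let gap_law k B : measurable B -> P (gap k @^-1` B) = exponential_prob 1 B.
Proof. by case: S_poisson => _ _; exact. Qed.

Let mpreimage (Y : {RV P >-> R}) B : measurable B -> measurable (Y @^-1` B).
Proof. by move=> mB; exact: measurable_funPTI. Qed.

Let bigcap_gap (J : {fset nat}) (B : nat -> set R) :=
  \bigcap_(j in [set` J]) gap j @^-1` B j.

Let mbigcap_gap J B : (forall j, measurable (B j)) -> measurable (bigcap_gap J B).
Proof.
by move=> mB; apply: fin_bigcap_measurable => // j _; exact: mpreimage.
Qed.

Let bigcap_gapU1 k A (J : {fset nat}) (B : nat -> set R) : k \notin J ->
  bigcap_gap (k |` J)%fset (fun j => if j == k then A else B j) =
  gap k @^-1` A `&` bigcap_gap J B.
Proof.
move=> kJ; apply/seteqP; split => w.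
  move=> h; split; first by have := h k; rewrite eqxx; apply; rewrite /= !inE eqxx.
  move=> j /= jJ; have := h j; case: ifPn => [/eqP jk|_].
    by move: kJ; rewrite -jk jJ.
  by apply; rewrite /= !inE jJ orbT.
move=> [h1 h2] j /=; rewrite !inE; case: ifPn => [/eqP-> _//|_ /= jJ].
exact: h2.
Qed.

Let bigcap_gap_indep k A J B : k \notin J -> measurable A ->
  (forall j, measurable (B j)) ->
  P (gap k @^-1` A `&` bigcap_gap J B) = P (gap k @^-1` A) * P (bigcap_gap J B).
Proof.
move=> kJ mA mB; rewrite -bigcap_gapU1// gap_indep//; last by move=> j; case: ifP.
rewrite big_fsetU1//= eqxx gap_indep//; congr *%E.
apply: eq_big_seq => j jJ; case: ifPn => // /eqP jk.
by move: kJ; rewrite -jk jJ.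
Qed.

(** The [k]-th arrival time is independent of the gaps of index at least [k]. In the induction step
    [S k.+1] is the sum of the pair formed by [S k] and gap [k]; quantifying over [J] lets the
    induction hypothesis absorb gap [k]. *)
Let arrival_gaps_indep k : forall (J : {fset nat}) B A,
  (forall j, j \in J -> (k <= j)%N) ->
  (forall j, measurable (B j)) -> measurable A ->
  P (S k @^-1` A `&` bigcap_gap J B) = P (S k @^-1` A) * P (bigcap_gap J B).
Proof.
elim: k => [|k IH] J B A kJ mB mA.
  have [A0|A0] := pselect (A 0%R).
    rewrite (_ : _ @^-1` A = setT); first by rewrite setTI probability_setT mul1e.
    by rewrite -subTset => w _ /=; rewrite S0.
  rewrite (_ : _ @^-1` A = set0); first by rewrite set0I measure0 mul0e.
  by rewrite -subset0 => w /=; rewrite S0.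
have kNJ : k \notin J by apply/negP => /kJ; rewrite ltnn.
pose fg w := (S k w, gap k w).
have mD : measurable [set u : R * R | A (u.1 + u.2)%R].
  have mf : measurable_fun setT (fun u : R * R => u.1 + u.2)%R.
    by apply: measurable_funD.
  by have := mf measurableT A mA; rewrite setTI.
have -> : S k.+1 @^-1` A = fg @^-1` [set u : R * R | A (u.1 + u.2)%R].
  by apply/seteqP; split => w /=; rewrite /interarrival addrC subrK.
apply: indep_event_preimage_pair => //; first exact: mbigcap_gap.
move=> A1 A2 mA1 mA2.
(* The induction hypothesis for [K] enlarged by [k] splits the probability into three factors. It is
   used with [K] empty, for the pair alone, and with [K = J]. *)
have IHk C : (forall j, measurable (C j)) -> forall K : {fset nat},
    (forall j, j \in K -> (k < j)%N) ->
    P (S k @^-1` A1 `&` (gap k @^-1` A2 `&` bigcap_gap K C)) =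
    P (S k @^-1` A1) * (P (gap k @^-1` A2) * P (bigcap_gap K C)).
  move=> mC K kK.
  have kNK : k \notin K by apply/negP => /kK; rewrite ltnn.
  rewrite -bigcap_gap_indep// -bigcap_gapU1//; apply: IH => //.
    by move=> j; rewrite !inE => /predU1P[->//|/kK /ltnW].
  by move=> j; case: ifP.
have P0 : bigcap_gap fset0 (fun=> setT) = setT.
  by rewrite -subTset => w _ j.
have := IHk (fun=> setT) (fun=> measurableT) fset0.
rewrite P0 setIT probability_setT mule1 => ->; last by move=> j; rewrite inE.
by rewrite -setIA IHk// muleA.
Qed.

Lemma arrival_interarrival_indep k A B : measurable A -> measurable B ->
  P (S k @^-1` A `&` interarrival S k @^-1` B) =
  P (S k @^-1` A) * P (interarrival S k @^-1` B).
Proof.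
move=> mA mB.
have := @arrival_gaps_indep k [fset k]%fset (fun=> B) A.
have -> : bigcap_gap [fset k]%fset (fun=> B) = interarrival S k @^-1` B.
  apply/seteqP; split => w; first by apply; rewrite /= inE.
  by move=> h j /=; rewrite inE => /eqP ->.
by apply => // j; rewrite inE => /eqP ->.
Qed.

(** By independence the law of the arrival time and the following gap is a product measure, so the
    law of their sum is a convolution. *)
Lemma next_arrival_cdf k t :
  P (S k.+1 @^-1` `]-oo, t]) =
  \int[lebesgue_measure]_s
    ((exponential_pdf 1 s)%:E * P (S k @^-1` `]-oo, (t - s)%R])).
Proof.
have mfg : measurable_fun setT (fun w => (S k w, gap k w)).
  exact: measurable_fun_pair.
pose fg : {RV P >-> (R * R)%type} :=
  HB.pack (fun w => (S k w, gap k w)) (isMeasurableFun.Build _ _ _ _ _ mfg).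
pose D := [set u : R * R | (u.1 + u.2 <= t)%R].
have mD : measurable D.
  have mf : measurable_fun setT (fun u : R * R => u.1 + u.2 <= t)%R.
    by apply: measurable_fun_ler => //; apply: measurable_funD.
  rewrite (_ : D = (fun u : R * R => u.1 + u.2 <= t)%R @^-1` [set true])//.
  by have := mf measurableT [set true] I; rewrite setTI.
have -> : S k.+1 @^-1` `]-oo, t] = fg @^-1` D.
  have e w : (S k w + interarrival S k w)%R = S k.+1 w.
    by rewrite /interarrival addrC subrK.
  by apply/seteqP; split => w /=; rewrite in_itv/= /D/= e.
have -> : P (fg @^-1` D) = (distribution P (S k) \x distribution P (gap k)) D.
  apply/esym/(@product_measure_unique _ _ _ _ _ _ _ (distribution P fg)) => //.
  exact: arrival_interarrival_indep.
pose f (u : R * R) := ((exponential_pdf 1 u.2)%:E * (\1_D u)%:E).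
have f0 u : 0 <= f u.
  by rewrite mule_ge0// lee_fin ?exponential_pdf_ge0.
have mf : measurable_fun setT f.
  apply: emeasurable_funM.
    apply/measurable_EFinP; apply: measurableT_comp => //.
    exact: measurable_exponential_pdf.
  by apply/measurable_EFinP/measurable_indic.
(* Integrating over the gap first brings in its density; Tonelli then leaves the law of [S k] as the
   inner integral. *)
transitivity (\int[distribution P (S k)]_u \int[lebesgue_measure]_s f (u, s)).
  apply: eq_integral => u _ /=.
  rewrite [LHS]gap_law; last exact: measurable_xsection.
  rewrite /exponential_prob integral_mkcond; apply: eq_integral => s _.
  rewrite /f/= patchE indicE mem_xsection.
  by case: ifP => _; rewrite ?mule1 ?mule0.
rewrite fubini_tonelli//; apply: eq_integral => s _.
have -> : S k @^-1` `]-oo, (t - s)%R] = S k @^-1` ysection D s.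
  apply/seteqP; split => w /=; rewrite in_itv/= /ysection/= inE/= => h.
    by rewrite lerBrDr in h.
  by rewrite lerBrDr.
have mDs := measurable_ysection s mD.
rewrite -[P _]/(distribution P (S k) (ysection D s)) -[ysection D s]setIT.
rewrite -integral_indic// -ge0_integralZl//=; last 2 first.
  exact/measurable_EFinP/measurable_indic.
  by rewrite lee_fin exponential_pdf_ge0.
apply: eq_integral => u _; rewrite /f/=; congr (_ * (_)%:E).
by rewrite !indicE mem_ysection.
Qed.

(** The Erlang law, by induction on [k]: the density vanishes for [s < 0] and the previous
    distribution function for [s > t], which cuts the convolution down to [[0, t]]. *)
Lemma arrival_cdf k t : P (S k @^-1` `]-oo, t]) =
  (if (0 <= t)%R then 1 - expR (- t) * exp_sum k t else 0)%:E.
Proof.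
elim: k t => [|k IH] t.
  case: ifPn => t0.
    rewrite (_ : _ @^-1` _ = setT) ?probability_setT.
      by rewrite /exp_sum big_ord0 mulr0 subr0.
    by rewrite -subTset => w _ /=; rewrite S0 in_itv.
  rewrite (_ : _ @^-1` _ = set0) ?measure0//.
  by rewrite -subset0 => w /=; rewrite S0 in_itv/= (negbTE t0).
rewrite next_arrival_cdf.
transitivity (\int[lebesgue_measure]_(s in `[0%R, t])
     (expR (- s) * (1 - expR (- (t - s)) * exp_sum k (t - s))%R)%:E).
  rewrite [RHS]integral_mkcond; apply: eq_integral => s _.
  rewrite patchE mem_setE in_itv/= IH subr_ge0.
  have [s0|s0] := leP 0%R s; last by rewrite lt0_exponential_pdf// mul0e.
  rewrite exponential_pdfE// mul1r mulN1r -EFinM.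
  by case: ifP => _ //; rewrite mulr0.
case: ifPn => t0; last first.
  rewrite integral_mkcond integral0_eq// => s _; rewrite patchE ifF//.
  apply/negbTE; rewrite mem_setE in_itv/=; apply: contra t0 => /andP[].
  exact: le_trans.
move: t0; rewrite le_eqVlt => /predU1P[<-|t0]; last exact: integral_expR_exp_sum.
by rewrite set_itv1 integral_set1 exp_sum0 oppr0 expR0 mulr1 subrr.
Qed.

End poisson_arrivals_theory.

(** * First hits, prophet and threshold payoffs *)

Section random_index.
Context d d' (T : measurableType d) (U : measurableType d').

Lemma measurable_fun_random_index (N : T -> nat) (F : nat -> T -> U) :
  (forall n, measurable (N @^-1` [set n])) ->
  (forall n, measurable_fun setT (F n)) ->
  measurable_fun setT (fun w => F (N w) w).
Proof.
move=> mN mF _ B mB; rewrite setTI.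
rewrite (_ : _ @^-1` B = \bigcup_n (N @^-1` [set n] `&` F n @^-1` B)).
  apply: bigcupT_measurable => n; apply: measurableI => //.
  by rewrite -[X in measurable X]setTI; exact: mF.
apply/seteqP; split => w /=; first by exists (N w).
by move=> [n _ [/= <-]].
Qed.

End random_index.

Section family_sigma_theory.
Context d (T : measurableType d).
Context d' (U : measurableType d') (D : set nat) (Y : nat -> T -> U).

Lemma family_sigma_preimage k B : D k -> measurable B ->
  family_sigma D Y (Y k @^-1` B).
Proof.
move=> Dk mB; apply: sub_gen_smallest; exists k => //.
by exists B => //; rewrite setTI.
Qed.

Lemma family_sigma_bigcap (J : set nat) (F : nat -> set T) :
  (forall j, J j -> family_sigma D Y (F j)) ->
  family_sigma D Y (\bigcap_(j in J) F j).
Proof.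
move=> mF; rewrite /family_sigma.
exact: (@bigcap_measurableType _ (g_sigma_algebraType _) F J).
Qed.

Lemma family_sigmaI A B : family_sigma D Y A -> family_sigma D Y B ->
  family_sigma D Y (A `&` B).
Proof.
by move=> mA mB; exact: (@measurableI _ (g_sigma_algebraType _) A B).
Qed.

Lemma family_sigma0 : family_sigma D Y set0.
Proof. exact: (@measurable0 _ (g_sigma_algebraType _)). Qed.

End family_sigma_theory.

Section first_hit.
Local Open Scope ereal_scope.
Context d (T : measurableType d) (R : realType).
Implicit Types (X : nat -> T -> R) (A B : set R).

(** [B] need not be the complement of [A]: a threshold rule waits while the values are below [x],
    whereas the event of interest also asks the stopped value to exceed [y]. *)
Definition first_hit X n A B : set T := X n.+1 @^-1` A `&`
  \bigcap_(j in [set j | (1 <= j <= n)%N]) X j @^-1` B.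

Lemma family_sigma_first_hit X (D : set nat) n A B :
  (forall j, (1 <= j <= n.+1)%N -> D j) -> measurable A -> measurable B ->
  family_sigma D X (first_hit X n A B).
Proof.
move=> nD mA mB; apply: family_sigmaI.
  by apply: family_sigma_preimage => //; apply: nD; rewrite /= ltnSn.
apply: family_sigma_bigcap => j /= /andP[j1 jn].
by apply: family_sigma_preimage => //; apply: nD; rewrite j1 ltnW.
Qed.

Lemma measurable_first_hit X n A B : (forall k, measurable_fun setT (X k)) ->
  measurable A -> measurable B -> measurable (first_hit X n A B).
Proof.
move=> mX mA mB; apply: measurableI.
  by rewrite -[X in measurable X]setTI; exact: mX.
apply: bigcap_measurableType => j _.
by rewrite -[X in measurable X]setTI; exact: mX.
Qed.

Let Fixpoint up_to n : {fset nat} :=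
  if n is m.+1 then (n |` up_to m)%fset else fset0.

Let in_up_to n j : (j \in up_to n) = (1 <= j <= n)%N.
Proof.
elim: n => [|n IH] /=; first by rewrite inE; case: j.
by rewrite !inE IH (leq_eqVlt j n.+1) ltnS; case: eqP => [->|].
Qed.

Variable P : probability T R.

Lemma probability_first_hit (Y : {RV P >-> R}) (X : nat -> {RV P >-> R}) n A B :
  mutually_independent P [set k | (1 <= k)%N] X ->
  (forall k C, (1 <= k)%N -> measurable C ->
    P (X k @^-1` C) = P (Y @^-1` C)) ->
  measurable A -> measurable B ->
  P (first_hit X n A B) = P (Y @^-1` A) * P (Y @^-1` B) ^+ n.
Proof.
move=> indX lawX mA mB.
have nJ : n.+1 \notin up_to n by rewrite in_up_to ltnn.
have -> : first_hit X n A B = \bigcap_(j in [set` (n.+1 |` up_to n)%fset])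
    X j @^-1` (if j == n.+1 then A else B).
  apply/seteqP; split => w.
    move=> [h1 h2] j /=; rewrite !inE; case: ifPn => [/eqP-> _//|_ /=].
    by rewrite in_up_to => /h2.
  move=> h; split.
    by have := h n.+1; rewrite eqxx; apply; rewrite /= !inE eqxx.
  move=> j /= /andP[j1 jn]; have := h j; rewrite ltn_eqF ?ltnS//; apply.
  by rewrite /= !inE in_up_to j1 jn orbT.
rewrite indX; last 2 first.
  - by move=> j /=; rewrite !inE in_up_to => /predU1P[->//|/andP[]].
  - by move=> j; case: ifP.
rewrite big_fsetU1//= eqxx lawX//; congr *%E.
transitivity (\prod_(j <- up_to n) P (Y @^-1` B)).
  apply: eq_big_seq => j; rewrite in_up_to => /andP[j1 jn].
  by rewrite ltn_eqF ?ltnS// lawX.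
elim: n {nJ} => [|n IH]; first by rewrite big_seq_fset0.
rewrite [up_to _]/= big_fsetU1 ?in_up_to ?ltnn// IH; exact/esym/expeS.
Qed.

End first_hit.

(** * The payoff of the prophet as a random variable *)

Section prophet_payoff.
Context d (T : measurableType d) (R : realType) (P : probability T R).
Context (X S : nat -> {RV P >-> R}) (t : R).

Let measurable_arrived k : measurable [set w | S k w <= t].
Proof.
rewrite (_ : [set _ | _] = S k @^-1` `]-oo, t]); first exact: measurable_funPTI.
by apply/seteqP; split => w /=; rewrite in_itv.
Qed.

Lemma measurable_arrival_count n : measurable (arrival_count S t @^-1` [set n]).
Proof.
pose last_arrival n := [set w | S n w <= t /\ forall k, S k w <= t -> (k <= n)%N].
have last_arrivalE m w : last_arrival m w -> arrival_count S t w = m.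
  move=> [Sm mS]; rewrite /arrival_count; case: xgetP => [k _ [Sk kS]|/(_ m)[]//].
  by apply/eqP; rewrite eqn_leq mS ?kS.
have mlast m : measurable (last_arrival m).
  rewrite (_ : last_arrival m = [set w | S m w <= t] `&`
      \bigcap_k ([set w | (k <= m)%N] `|` ~` [set w | S k w <= t])).
    apply: measurableI => //; apply: bigcapT_measurable => k.
    apply: measurableU; last exact: measurableC.
    by case: (k <= m)%N; rewrite ?set_true ?set_false.
  apply/seteqP; split => w [Sm mS]; split => // k.
    by move=> _; have [Sk|Sk] := pselect (S k w <= t); [left; exact: mS|right].
  by move=> Sk; case: (mS k I).
(* The count 0 is also the default when there is no last arrival, so its event is obtained as the
   complement of all the others. *)
case: n => [|n].
  rewrite (_ : _ @^-1` _ = ~` \bigcup_n last_arrival n.+1).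
    by apply: measurableC; exact: bigcupT_measurable.
  apply/seteqP; split => w /=.
    by move=> N0 [k _ /last_arrivalE]; rewrite N0.
  move=> h; rewrite /arrival_count; case: xgetP => // -[//|k] _ Pk.
  by exfalso; apply: h; exists k.
rewrite (_ : _ @^-1` _ = last_arrival n.+1)//.
apply/seteqP; split => w /=; last exact: last_arrivalE.
rewrite /arrival_count; case: xgetP => // k _ Pk kn.
by rewrite -kn.
Qed.

Lemma measurable_max_upto n : measurable_fun setT (max_upto X n).
Proof.
case: n => [|n]; first exact: measurable_cst.
rewrite /max_upto; elim: (index_iota _ _) => [|k s IH].
  by under eq_fun do rewrite big_nil; exact: measurable_funPT.
by under eq_fun do rewrite big_cons; exact: measurable_maxr.
Qed.

Lemma max_upto_gt n y w : 0 <= y -> y < max_upto X n w ->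
  exists2 k, (k < n)%N & y < X k.+1 w.
Proof.
move=> y0; case: n => [|n]; first by rewrite ltNge y0.
rewrite /max_upto; have : forall k, k \in index_iota 1 n.+2 -> (1 <= k <= n.+1)%N.
  by move=> k; rewrite mem_index_iota.
elim: (index_iota _ _) => [|k s IH] sn; first by rewrite big_nil; exists 0%N.
rewrite big_cons lt_max => /orP[yX|].
  have := sn k (mem_head _ _); case: k yX {IH sn} => // k yX kn.
  by exists k.
by apply: IH => j js; apply: sn; rewrite inE js orbT.
Qed.

Lemma max_upto_itv n b w : 0 <= b ->
  (forall k, (1 <= k)%N -> 0 <= X k w <= b) -> 0 <= max_upto X n w <= b.
Proof.
move=> b0 X0b; case: n => [|n]; first by rewrite lexx.
rewrite /max_upto big_nat; elim/big_ind: _ => //.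
- exact: X0b.
- by move=> x y /andP[x0 xb] /andP[y0 yb]; rewrite le_max x0 ge_max xb yb.
- by move=> k /andP[k1 _]; exact: X0b.
Qed.

Definition prophet_payoff (w : T) : R := max_upto X (arrival_count S t w) w.

Lemma measurable_prophet_payoff : measurable_fun setT prophet_payoff.
Proof.
apply: (@measurable_fun_random_index _ _ _ _ (arrival_count S t) (max_upto X)).
  exact: measurable_arrival_count.
exact: measurable_max_upto.
Qed.

HB.instance Definition _ :=
  isMeasurableFun.Build _ _ _ _ prophet_payoff measurable_prophet_payoff.

End prophet_payoff.

(** * Threshold stopping rules and their payoffs *)

Section threshold_rule.
Context d (T : measurableType d) (R : realType) (P : probability T R).
Context (X S : nat -> {RV P >-> R}) (x : R) (n : nat).

(* A stopping rule must be finite everywhere, so the rule gives up at the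
   observation [n.+1]. *)
Definition threshold_rule (w : T) : nat :=
  (find (fun k => x <= X k w) (iota 1 n)).+1.

Lemma threshold_rule_first_hit m : (m < n)%N ->
  threshold_rule @^-1` [set m.+1] = first_hit X m `[x, +oo[ `]-oo, x[.
Proof.
move=> mn; apply/seteqP; split => w /=.
  move=> [fm]; split => /=.
    rewrite in_itv/= andbT -add1n -(nth_iota 0 _ mn) -fm.
    apply: (@nth_find _ 0%N (fun k => x <= X k w)).
    by rewrite has_find size_iota fm.
  move=> [//|j] /= jm; rewrite in_itv/= ltNge -add1n.
  rewrite -(nth_iota 0 1 (ltn_trans jm mn)).
  by rewrite (@before_find _ 0%N (fun k => x <= X k w))// fm.
move=> [/=]; rewrite in_itv/= andbT => xX Xx; congr _.+1.
apply/eqP; rewrite eqn_leq; apply/andP; split.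
  rewrite leqNgt; apply/negP => /(before_find 0%N).
  by rewrite nth_iota// add1n xX.
rewrite leqNgt; apply/negP => fm.
have /(nth_find 0%N) : has (fun k => x <= X k w) (iota 1 n).
  by rewrite has_find size_iota (ltn_trans fm).
rewrite nth_iota ?(ltn_trans fm)// add1n leNgt => /negP; apply.
by have := Xx (find (fun k => x <= X k w) (iota 1 n)).+1; rewrite /= in_itv/=; exact.
Qed.

Lemma threshold_rule_no_hit : threshold_rule @^-1` [set n.+1] =
  \bigcap_(j in [set j | (1 <= j <= n)%N]) X j @^-1` `]-oo, x[.
Proof.
apply/seteqP; split => w /=.
  move=> [fn] [//|j] /= jn; rewrite in_itv/= ltNge -add1n.
  rewrite -(nth_iota 0 1 jn).
  by rewrite (@before_find _ 0%N (fun k => x <= X k w))// fn.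
move=> Xx; congr _.+1; rewrite -[RHS](size_iota 1) hasNfind//.
apply/hasPn => k; rewrite mem_iota add1n -ltNge => kn.
by have /= := Xx k kn; rewrite in_itv.
Qed.

Lemma threshold_rule_le w : (threshold_rule w <= n.+1)%N.
Proof. by rewrite ltnS -[leqRHS](size_iota 1) find_size. Qed.

(** The threshold rule looks only at values, while stopping rules refer to the sigma-algebra of
    values and arrival times. *)
Let family_sigma_observation D A : family_sigma D X A ->
  family_sigma D (fun k w => (X k w, S k w)) A.
Proof.
apply: smallest_sub; first exact: smallest_sigma_algebra.
move=> _ [k Dk [B mB <-]]; rewrite setTI.
rewrite (_ : X k @^-1` B = (fun w => (X k w, S k w)) @^-1` (B `*` setT)).
  by apply: (@family_sigma_preimage _ _ _ _ _ (fun k w => (X k w, S k w))) => //;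
    exact: measurableX.
by apply/seteqP; split => w //= [].
Qed.

Lemma stopping_rule_threshold : stopping_rule X S threshold_rule.
Proof.
split=> // -[//|m] _; apply: family_sigma_observation.
have [mn|nm|->] := ltngtP m n.
- by rewrite threshold_rule_first_hit//; exact: family_sigma_first_hit.
- rewrite (_ : _ @^-1` _ = set0); first exact: family_sigma0.
  rewrite -subset0 => w /= wm.
  by have := threshold_rule_le w; rewrite wm ltnS leqNgt nm.
- rewrite threshold_rule_no_hit; apply: family_sigma_bigcap => j /= /andP[j1 jn].
  by apply: family_sigma_preimage => //=; rewrite j1 ltnW.
Qed.

Let measurable_threshold_rule m : measurable (threshold_rule @^-1` [set m]).
Proof.
case: m => [|m]; first by rewrite (_ : _ @^-1` _ = set0)// -subset0.
have [mn|nm|->] := ltngtP m n.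
- by rewrite threshold_rule_first_hit//; exact: measurable_first_hit.
- rewrite (_ : _ @^-1` _ = set0)//.
  rewrite -subset0 => w /= wm.
  by have := threshold_rule_le w; rewrite wm ltnS leqNgt nm.
- rewrite threshold_rule_no_hit; apply: bigcap_measurableType => j _.
  exact: measurable_funPTI.
Qed.

Definition threshold_payoff (t : R) (w : T) : R :=
  X (threshold_rule w) w * \1_[set v | S (threshold_rule v) v <= t] w.

Lemma measurable_threshold_payoff t : measurable_fun setT (threshold_payoff t).
Proof.
have mrule (Z : nat -> {RV P >-> R}) :
    measurable_fun setT (fun w => Z (threshold_rule w) w).
  exact: (@measurable_fun_random_index _ _ _ _ threshold_rule (fun k w => Z k w)).
apply: measurable_funM; first exact: mrule.
apply: measurable_indic.
rewrite (_ : [set _ | _] = (fun v => S (threshold_rule v) v) @^-1` `]-oo, t]).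
  by rewrite -[X in measurable X]setTI; exact: mrule.
by apply/seteqP; split => w /=; rewrite in_itv.
Qed.

HB.instance Definition _ t :=
  isMeasurableFun.Build _ _ _ _ (threshold_payoff t) (measurable_threshold_payoff t).

Lemma expectation_threshold_le_stopping_value t :
  ('E_P[threshold_payoff t] <= stopping_value X S t)%E.
Proof.
apply: ereal_sup_ubound; exists threshold_rule => //.
exact: stopping_rule_threshold.
Qed.

End threshold_rule.

(** * Tail bounds for the two payoffs *)

Section observations.
Local Open Scope ereal_scope.
Context d (T : measurableType d) (R : realType) (P : probability T R).
Context (Y : {RV P >-> R}) (X S : nat -> {RV P >-> R}) (t : R).
Hypothesis t0 : (0 <= t)%R.
Hypothesis indX : mutually_independent P [set k | (1 <= k)%N] X.
Hypothesis lawX : forall k (B : set R), (1 <= k)%N -> measurable B ->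
  P (X k @^-1` B) = P (Y @^-1` B).
Hypothesis S_poisson : poisson_arrivals 1 S.
Hypothesis indSX : indep_systems P (family_sigma [set k | (1 <= k)%N] S)
  (family_sigma [set k | (1 <= k)%N] X).

Definition arrived_first_hit n A B : set T :=
  S n.+1 @^-1` `]-oo, t] `&` first_hit X n A B.

Let mpreimage (Z : {RV P >-> R}) B : measurable B -> measurable (Z @^-1` B).
Proof. by move=> mB; exact: measurable_funPTI. Qed.

Lemma measurable_arrived_first_hit n A B : measurable A -> measurable B ->
  measurable (arrived_first_hit n A B).
Proof.
move=> mA mB; apply: measurableI; first exact: mpreimage.
exact: measurable_first_hit.
Qed.

Lemma probability_arrived_first_hit n A B : measurable A -> measurable B ->
  P (arrived_first_hit n A B) = ((1 - expR (- t) * exp_sum n.+1 t) *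
    fine (P (Y @^-1` A)) * fine (P (Y @^-1` B)) ^+ n)%:E.
Proof.
move=> mA mB; rewrite indSX; last 2 first.
- exact: family_sigma_preimage.
- by apply: family_sigma_first_hit => // j /andP[].
rewrite arrival_cdf// t0 (probability_first_hit _ indX lawX)//.
by rewrite -mulrA EFinM EFinM EFin_expe !fineK ?fin_num_measure//;
  exact: mpreimage.
Qed.

(** Off this null event the arrival times are nondecreasing, so every observation preceding an
    arrived one has arrived too. *)
Lemma negative_interarrival_null :
  P (\bigcup_k interarrival S k @^-1` `]-oo, 0%R[) = 0.
Proof.
have mN k : measurable (interarrival S k @^-1` `]-oo, 0%R[) by exact: mpreimage.
apply/eqP; rewrite eq_le measure_ge0 andbT.
rewrite (le_trans (measure_sigma_subadditive _ mN _ (@subset_refl _ _)))//.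
  exact: bigcupT_measurable.
rewrite eseries0// => k _ _.
have [_ _ lawS] := S_poisson.
apply: (etrans (lawS k `]-oo, 0%R[%classic (measurable_itv _))).
rewrite /exponential_prob integral0_eq// => s; rewrite /= in_itv/= => s0.
by rewrite lt0_exponential_pdf.
Qed.

(** If the maximum exceeds [y], then, off a null event, the first observation above [y] has arrived
    by time [t]. Summing over its index gives a thinning sum, bounded by its limit. *)
Lemma prophet_payoff_tail (y : R) : (0 <= y)%R ->
  P (prophet_payoff X S t @^-1` `]y, +oo[) <=
  (1 - expR (- (t * fine (P (Y @^-1` `]y, +oo[)))))%:E.
Proof.
move=> y0; set G := fine _.
have mYy : measurable (Y @^-1` `]y, +oo[) by exact: mpreimage.
pose Neg := \bigcup_k interarrival S k @^-1` `]-oo, 0%R[.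
pose hit n := arrived_first_hit n `]y, +oo[ `]-oo, y].
have mhit n : measurable (hit n) by exact: measurable_arrived_first_hit.
have mNeg : measurable Neg by apply: bigcupT_measurable => k; exact: mpreimage.
have mH : measurable (\bigcup_n hit n) by exact: bigcupT_measurable.
have G01 : (0 <= G <= 1)%R.
  by rewrite fine_ge0//= -lee_fin fineK ?fin_num_measure ?probability_le1.
have sub : prophet_payoff X S t @^-1` `]y, +oo[ `<=` Neg `|` \bigcup_n hit n.
  move=> w /=; rewrite in_itv/= andbT => yM.
  have [|wN] := pselect (Neg w); [by left|right].
  have ndS : {homo S ^~ w : m n / (m <= n)%N >-> (m <= n)%R}.
    apply/nondecreasing_seqP => n; rewrite leNgt; apply/negP => Sn.
    by apply: wN; exists n => //=; rewrite in_itv/= /interarrival subr_lt0.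
  have [k kN yX] := max_upto_gt y0 yM.
  (* [k < arrival_count S t w] makes the count positive, hence not the default value. *)
  have SN : (S (arrival_count S t w) w <= t)%R.
    move: kN; rewrite /arrival_count; case: xgetP => // n _ [Sn _] _.
    exact: Sn.
  have exk : exists k, (y < X k.+1 w)%R by exists k.
  have [m yXm mmin] := ex_minnP exk.
  exists m => //; split; [|split] => /=.
  - by rewrite in_itv/= (le_trans _ SN)// ndS// (leq_ltn_trans (mmin _ yX)).
  - by rewrite in_itv/= yXm.
  - move=> [//|j] /= jm; rewrite in_itv/= leNgt; apply/negP => /mmin.
    by rewrite leqNgt jm.
have mY : measurable (prophet_payoff X S t @^-1` `]y, +oo[) by exact: mpreimage.
apply: (le_trans (le_measure _ _ _ sub)); rewrite ?inE//; first exact: measurableU.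
apply: (le_trans (measureU2 _ mNeg mH)).
have PNeg : P Neg <= 0 by rewrite negative_interarrival_null.
apply: (le_trans (leeD PNeg
  (measure_sigma_subadditive _ mhit mH (@subset_refl _ _)))).
rewrite add0e.
apply: lime_le; first exact: is_cvg_nneseries.
near=> n; rewrite big_mkord.
have Phit k := probability_arrived_first_hit k
  (measurable_itv `]y, +oo[) (measurable_itv `]-oo, y]).
rewrite (eq_bigr _ (fun k _ => Phit (nat_of_ord k))) sumEFin lee_fin.
have -> : fine (P (Y @^-1` `]-oo, y])) = (1 - G)%R.
  rewrite (_ : `]-oo, y]%classic = ~` `]y, +oo[%classic); last by rewrite setCitvr.
  rewrite preimage_setC probability_setC//.
  by rewrite fineB ?fin_num_measure.
rewrite (le_trans _ (thinning_le n t0 G01))// /thinning mulr_sumr.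
rewrite le_eqVlt; apply/orP; left; apply/eqP; apply: eq_bigr => k _.
by rewrite -/G; ring.
Unshelve. all: by end_near. Qed.

(** Stopping at observation [m.+1] by time [t] with a value that is at least [x] and exceeds [y]
    gives disjoint events for [m < n]. The observation at which the rule gives up is discarded,
    whence an inequality. *)
Lemma threshold_payoff_tail n (x y : R) : (0 <= y)%R ->
  (thinning n (fine (P (Y @^-1` `[x, +oo[))) t *
   fine (P (Y @^-1` (`[x, +oo[ `&` `]y, +oo[))))%:E <=
  P (threshold_payoff X S x n t @^-1` `]y, +oo[).
Proof.
move=> y0; set g := fine (P _); set h := fine _.
pose hit m := arrived_first_hit m (`[x, +oo[ `&` `]y, +oo[) `]-oo, x[.
have mxy : measurable (`[x, +oo[ `&` `]y, +oo[ : set R) by exact: measurableI.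
have mhit m : measurable (hit m) by exact: measurable_arrived_first_hit.
have tI : trivIset setT hit.
  apply/trivIsetP.
  have hit_lt i j w : (i < j)%N -> ~ (hit i w /\ hit j w).
    move=> ij [[_ [/= [+ _] _]] [_ [_ /(_ i.+1)]]].
    by rewrite /= !in_itv/= andbT ij => xX /(_ isT); rewrite ltNge xX.
  move=> i j _ _; rewrite neq_ltn => /orP[] ij; rewrite -subset0 => w.
    exact: (hit_lt _ _ w ij).
  by move=> [hi hj]; exact: (hit_lt _ _ w ij (conj hj hi)).
have mZ : measurable (threshold_payoff X S x n t @^-1` `]y, +oo[) by exact: mpreimage.
have -> : (thinning n g t * h)%:E = P (\big[setU/set0]_(m < n) hit m).
  rewrite measure_bigsetU//.
  have Phit m := probability_arrived_first_hit m mxy (measurable_itv `]-oo, x[).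
  rewrite (eq_bigr _ (fun m _ => Phit (nat_of_ord m))) sumEFin; congr EFin.
  have mYx : measurable (Y @^-1` `[x, +oo[) by exact: mpreimage.
  have -> : fine (P (Y @^-1` `]-oo, x[)) = (1 - g)%R.
    rewrite (_ : `]-oo, x[%classic = ~` `[x, +oo[%classic); last by rewrite setCitvr.
    by rewrite preimage_setC probability_setC// fineB ?fin_num_measure.
  rewrite /thinning mulr_suml; apply: eq_bigr => m _; rewrite -/h; ring.
apply: le_measure; rewrite ?inE//; first by apply: bigsetU_measurable.
rewrite -bigcup_mkord => w [m /= mn [/= Sm [[xX yX] Xx]]].
have rule_w : threshold_rule X x n w = m.+1.
  have : first_hit X m `[x, +oo[ `]-oo, x[ w by split.
  by rewrite -(@threshold_rule_first_hit _ _ _ _ _ _ n).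
rewrite /threshold_payoff rule_w indicE mem_set ?mulr1//=.
by rewrite rule_w; move: Sm; rewrite in_itv.
Qed.

End observations.

(** * The bound for an arbitrary threshold *)

Section threshold_bound.
Local Open Scope ereal_scope.
Context d (T : measurableType d) (R : realType) (P : probability T R).
Context (Y : {RV P >-> R}) (X S : nat -> {RV P >-> R}) (t b x : R).
Hypothesis t_gt0 : (0 < t)%R.
Hypothesis x0b : (0 <= x <= b)%R.
Hypothesis X0b : forall k w, (1 <= k)%N -> (0 <= X k w <= b)%R.
Hypothesis indX : mutually_independent P [set k | (1 <= k)%N] X.
Hypothesis lawX : forall k (B : set R), (1 <= k)%N -> measurable B ->
  P (X k @^-1` B) = P (Y @^-1` B).
Hypothesis S_poisson : poisson_arrivals 1 S.
Hypothesis indSX : indep_systems P (family_sigma [set k | (1 <= k)%N] S)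
  (family_sigma [set k | (1 <= k)%N] X).

Let mu : {measure set _ -> \bar R} := @lebesgue_measure R.
Let t0 : (0 <= t)%R := ltW t_gt0.
Let g : R := fine (P (Y @^-1` `[x, +oo[)).
(** For nonzero [g] this is the limit of [thinning n g t]; for [g = 0] it is 0, since division by 0
    gives 0. *)
Let kappa : R := ((1 - expR (- (t * g))) / g)%R.
Let tail (y : R) : R := fine (P (Y @^-1` (`[x, +oo[ `&` `]y, +oo[))).

Let mpreimage B : measurable B -> measurable (Y @^-1` B).
Proof. by move=> mB; exact: measurable_funPTI. Qed.

Let mxy y : measurable (`[x, +oo[ `&` `]y, +oo[ : set R).
Proof. exact: measurableI. Qed.

Let fineP_itv B : measurable B -> (0 <= fine (P (Y @^-1` B)) <= 1)%R.
Proof.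
move=> mB; rewrite fine_ge0//= -lee_fin fineK ?probability_le1//.
  exact: mpreimage.
by rewrite fin_num_measure//; exact: mpreimage.
Qed.

Let le_fineP B C : measurable B -> measurable C -> B `<=` C ->
  (fine (P (Y @^-1` B)) <= fine (P (Y @^-1` C)))%R.
Proof.
move=> mB mC BC; have ? := mpreimage mB; have ? := mpreimage mC.
rewrite fine_le ?fin_num_measure// le_measure ?inE//.
exact: preimage_subset.
Qed.

Let g01 : (0 <= g <= 1)%R. Proof. exact: fineP_itv. Qed.

Let tail01 y : (0 <= tail y <= 1)%R. Proof. exact: fineP_itv. Qed.

Let measurable_tail D : measurable D -> measurable_fun D tail.
Proof.
move=> mD; apply: nonincreasing_measurable => // y z yz; rewrite /tail.
apply: (le_fineP (mxy _) (mxy _)) => u /= []; rewrite !in_itv/= !andbT => xu zu.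
by split => //; exact: le_lt_trans zu.
Qed.

Let kappa_ge0 : (0 <= kappa)%R.
Proof.
have /andP[g0 _] := g01.
by rewrite divr_ge0// one_sub_expRN_ge0// mulr_ge0.
Qed.

Let kappaE : (kappa * g = 1 - expR (- (t * g)))%R.
Proof.
rewrite /kappa; have [->|g0] := eqVneq g 0%R; last by rewrite divfK.
by rewrite !mulr0 oppr0 expR0 subrr.
Qed.

(** [low] and [high] are the errors [p - q] and [q * beta t / p], committed below and above the
    threshold. *)
Let low : R := (expR (- (t * g)) - expR (- t))%R.
Let high : R := ((1 - expR (- (t * g))) * (beta t / (1 - expR (- t))))%R.

Let low_ge0 : (0 <= low)%R.
Proof.
have /andP[g0 g1] := g01.
by rewrite subr_ge0 ler_expR lerN2 ger_pMr.
Qed.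

Let high_ge0 : (0 <= high)%R.
Proof.
have /andP[g0 g1] := g01.
apply: mulr_ge0; first by rewrite one_sub_expRN_ge0// mulr_ge0.
by rewrite divr_ge0 ?beta_ge0 ?one_sub_expRN_ge0.
Qed.

Let prophet_tail_le (y : R) : (0 <= y <= b)%R ->
  (1 - expR (- (t * fine (P (Y @^-1` `]y, +oo[)))) <=
   kappa * tail y + (low * \1_`[0%R, x[ y + high * \1_`[x, b] y))%R.
Proof.
move=> /andP[y0 yb]; set G := fine _.
have /andP[G0 G1] : (0 <= G <= 1)%R by exact: fineP_itv.
have /andP[_ g1] := g01.
have [yx|xy] := ltP y x.
  (* Below [x] the condition [X > y] is implied by [X >= x], so [kappa * tail y = q], while the
     prophet's tail is at most [p = q + low]. *)
  have -> : tail y = g.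
    rewrite /tail/g; congr (fine (P (_ @^-1` _))); apply/setIidl => u.
    by rewrite /= !in_itv/= !andbT; exact: lt_le_trans.
  rewrite kappaE !indicE mem_set ?memNset/= ?in_itv/= ?y0//; last first.
    by rewrite leNgt yx.
  have : (expR (- t) <= expR (- (t * G)))%R by rewrite ler_expR lerN2 ger_pMr.
  by rewrite /low; lra.
(* From [x] on, [X > y] implies [X >= x]; hence [G <= g] and [one_sub_expRN_le_beta] applies. *)
have -> : tail y = G.
  rewrite /tail/G; congr (fine (P (_ @^-1` _))); apply/setIidr => u.
  by rewrite /= !in_itv/= !andbT => yu; rewrite (le_trans xy)// ltW.
rewrite !indicE memNset ?mem_set/= ?in_itv/= ?xy ?yb//; last first.
  by rewrite y0/= ltNge xy.
rewrite mulr0 add0r mulr1; apply: one_sub_expRN_le_beta => //.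
apply: le_fineP => // u.
by rewrite /= !in_itv/= !andbT => yu; rewrite (le_trans xy)// ltW.
Qed.

Let tail_integral := \int[mu]_(y in `[0%R, b]) (tail y)%:E.

Let tail_integral_ge0 : 0 <= tail_integral.
Proof.
by apply: integral_ge0 => y _; rewrite lee_fin; have /andP[] := tail01 y.
Qed.

(** Finiteness allows this integral to cancel in the final subtraction of extended reals. *)
Let tail_integral_fin : tail_integral \is a fin_num.
Proof.
have /andP[x0 xb] := x0b.
rewrite ge0_fin_numE//.
apply: (@le_lt_trans _ _ (\int[mu]_(y in `[0%R, b]) (cst 1 y))).
  apply: ge0_le_integral => //.
  - by move=> y _; rewrite lee_fin; have /andP[] := tail01 y.
  - by apply/measurable_EFinP; exact: measurable_tail.
  - by move=> y _; rewrite lee_fin; have /andP[] := tail01 y.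
rewrite integral_cst//= mul1e lebesgue_measure_itv/=.
by case: ifP => _; rewrite ltry.
Qed.

Let integral_indicZ (c : R) (B : set R) : (0 <= c)%R -> measurable B ->
  B `<=` `[0%R, b] ->
  \int[mu]_(y in `[0%R, b]) (c * \1_B y)%:E = c%:E * mu B.
Proof.
move=> c0 mB Bb; under eq_integral do rewrite EFinM.
rewrite ge0_integralZl//=.
  by rewrite integral_indic// setIidl.
by apply/measurable_EFinP; exact: measurable_indic.
Qed.

Let bound y : R :=
  (kappa * tail y + (low * \1_`[0%R, x[ y + high * \1_`[x, b] y))%R.

Let measurable_bound : measurable_fun `[0%R, b] bound.
Proof.
apply: measurable_funD.
  by apply: measurable_funM => //; exact: measurable_tail.
by apply: measurable_funD; apply: measurable_funM => //; exact: measurable_indic.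
Qed.

Let bound_ge0 y : (0 <= bound y)%R.
Proof.
have /andP[tail0 _] := tail01 y.
by rewrite !addr_ge0// mulr_ge0.
Qed.

Let integral_bound : \int[mu]_(y in `[0%R, b]) (bound y)%:E =
  kappa%:E * tail_integral + (low * x + high * (b - x))%:E.
Proof.
have /andP[x0 xb] := x0b.
under eq_integral do rewrite EFinD EFinD.
have mindic (c : R) (B : set R) : measurable B ->
    measurable_fun `[0%R, b] (fun y : R => (c * \1_B y)%:E : \bar R).
  move=> mB; apply/measurable_EFinP.
  by apply: measurable_funM => //; exact: measurable_indic.
have mktail : measurable_fun `[0%R, b] (fun y => (kappa * tail y)%:E : \bar R).
  by apply/measurable_EFinP; apply: measurable_funM => //; exact: measurable_tail.
have indic0 (c : R) (B : set R) y : (0 <= c)%R -> 0 <= (c * \1_B y)%:E :> \bar R.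
  by move=> c0; rewrite lee_fin mulr_ge0.
rewrite ge0_integralD//; last 3 first.
- by move=> y _; rewrite lee_fin mulr_ge0//; have /andP[] := tail01 y.
- by move=> y _; rewrite adde_ge0// indic0.
- by apply: emeasurable_funD; exact: mindic.
rewrite ge0_integralD//; [|by move=> y _; exact: indic0|exact: mindic
  |by move=> y _; exact: indic0|exact: mindic].
rewrite !integral_indicZ//; last 2 first.
- by move=> u; rewrite /= !in_itv/= => /andP[xu ->]; rewrite (le_trans x0).
- by move=> u; rewrite /= !in_itv/= => /andP[-> ux]; rewrite (le_trans (ltW ux)).
congr (_ + _).
  under eq_integral do rewrite EFinM.
  rewrite ge0_integralZl//; last first.
    by move=> y _; rewrite lee_fin; have /andP[] := tail01 y.
  by apply/measurable_EFinP; exact: measurable_tail.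
have itv_length (bl br : bool) (u v : R) : (u <= v)%R ->
    mu [set` Interval (BSide bl u) (BSide br v)] = (v - u)%:E.
  move=> uv; apply: (etrans (lebesgue_measure_itv _)); rewrite /= lte_fin.
  by case: ltgtP uv => // -> _; rewrite subrr.
by rewrite !itv_length// subr0.
Qed.

Let prophet_value_le : prophet_value X S t <=
  kappa%:E * tail_integral + (low * x + high * (b - x))%:E.
Proof.
have /andP[x0 xb] := x0b.
have payoff_itv w : (0 <= prophet_payoff X S t w <= b)%R.
  by apply: max_upto_itv => [|k]; [exact: le_trans xb|exact: X0b].
have -> : prophet_value X S t = 'E_P[prophet_payoff X S t] by [].
rewrite ge0_expectation_ccdf; last by move=> w; have /andP[] := payoff_itv w.
rewrite -integral_bound [leLHS]integral_mkcond [leRHS]integral_mkcond.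
apply: ge0_le_integral => //.
- by move=> y _; rewrite patchE; case: ifP => // _; exact: measure_ge0.
- apply/(measurable_restrictT _ _).1 => //; apply: measurable_funTS.
  exact: ccdf_measurable.
- by apply/(measurable_restrictT _ _).1 => //; exact/measurable_EFinP.
move=> y _; rewrite !patchE !mem_setE !in_itv/= andbT.
have [y0|y0] := leP 0%R y; last by [].
(* Beyond [b] the prophet's tail is zero, so the tail formula for the expectation only involves
   [[0, b]]. *)
have [yb|yb] := leP y b; last first.
  rewrite /= /ccdf /distribution /pushforward (_ : _ @^-1` _ = set0) ?measure0//.
  rewrite -subset0 => w /=; rewrite in_itv/= andbT ltNge.
  by have /andP[_ /le_trans->] := payoff_itv w; last exact: ltW.
apply: le_trans (prophet_payoff_tail t0 indX lawX S_poisson indSX y0) _.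
by rewrite lee_fin prophet_tail_le// y0.
Qed.

(** Each truncated threshold rule gives a lower bound through its tail; the truncation level [n]
    then tends to infinity. *)
Let le_stopping_value : kappa%:E * tail_integral <= stopping_value X S t.
Proof.
have /andP[x0 xb] := x0b.
have /andP[g0 g1] := g01.
have lower n : (thinning n g t)%:E * tail_integral <= stopping_value X S t.
  apply: le_trans (expectation_threshold_le_stopping_value X S x n t).
  have payoff_ge0 w : (0 <= threshold_payoff X S x n t w)%R.
    rewrite mulr_ge0//.
    by have /andP[] := X0b w (isT : (0 < threshold_rule X x n w)%N).
  rewrite ge0_expectation_ccdf//.
  have mtail : measurable_fun `[0%R, b] (EFin \o tail).
    by apply/measurable_EFinP; exact: measurable_tail.
  rewrite -ge0_integralZl//; last 2 first.
  - by move=> y _; rewrite lee_fin; have /andP[] := tail01 y.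
  - by rewrite lee_fin thinning_ge0.
  have mccdf D : measurable_fun D (ccdf (threshold_payoff X S x n t : {RV P >-> R})).
    by apply: measurable_funTS; exact: ccdf_measurable.
  apply: (@le_trans _ _ (\int[mu]_(y in `[0%R, b])
      ccdf (threshold_payoff X S x n t : {RV P >-> R}) y)).
    apply: ge0_le_integral => //.
    - move=> y _; rewrite mule_ge0// lee_fin ?thinning_ge0//.
      by have /andP[] := tail01 y.
    - exact: measurable_funeM.
    - exact: mccdf.
    - move=> y; rewrite /= in_itv/= => /andP[y0 _]; rewrite -EFinM.
      exact: threshold_payoff_tail.
  apply: ge0_subset_integral => //; first exact: mccdf.
  by move=> y; rewrite /= !in_itv/= andbT => /andP[].
rewrite -(fineK tail_integral_fin) -EFinM.
(* For [g = 0] the left-hand side is 0, and the empty thinning sum [n = 0] already shows that the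
   stopping value is nonnegative. *)
have [g_eq0|g_neq0] := eqVneq g 0%R.
  rewrite /kappa g_eq0 invr0 mulr0 mul0r.
  by have := lower 0%N; rewrite /thinning big_ord0 mul0e.
apply: (@cvge_le _ \oo _ _ (fun n => (thinning n g t * fine tail_integral)%:E)).
  by near=> n; rewrite EFinM fineK.
apply: cvg_EFin; first by near=> n.
apply: cvgMl => /=.
have -> : thinning ^~ g ^~ t = (fun n => g * thinning n g t * g^-1)%R.
  by apply/funext => n; rewrite mulrAC divff// mul1r.
by apply: cvgMl; exact: cvg_thinning.
Unshelve. all: by end_near. Qed.

Lemma prophet_sub_stopping_le :
  let q := (1 - expR (- (t * fine (P (Y @^-1` `[x, +oo[)))))%R in
  let p := (1 - expR (- t))%R in
  prophet_value X S t - stopping_value X S t <=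
  ((p - q) * x + q * (beta t / p) * (b - x))%:E.
Proof.
rewrite /= -/g; apply: (le_trans (leeB prophet_value_le le_stopping_value)).
rewrite -(fineK tail_integral_fin) -EFinM addeAC subee// add0e.
rewrite lee_fin le_eqVlt; apply/orP; left; apply/eqP; rewrite /low /high; ring.
Qed.

End threshold_bound.

(* X is the generic variable; Xs k, for k >= 1, is the k-th observation, made
   at time S k. The value Xs 0 is irrelevant. *)
Theorem corollary4p5 (d : measure_display) (T : measurableType d)
    (R : realType) (P : probability T R) (a b : R)
    (X : {RV P >-> R}) (Xs : nat -> {RV P >-> R}) (S : nat -> {RV P >-> R}) :
  0 <= a -> a < b ->
  (forall w, a <= X w <= b) ->
  (forall k w, (1 <= k)%N -> a <= Xs k w <= b) ->
  mutually_independent P [set k | (1 <= k)%N] Xs ->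
  (forall k (B : set R), (1 <= k)%N -> measurable B ->
     P (Xs k @^-1` B) = P (X @^-1` B)) ->
  (P [set w | X w = 0%R] < 1)%E ->
  poisson_arrivals 1 S ->
  indep_systems P (family_sigma [set k | (1 <= k)%N] S)
    (family_sigma [set k | (1 <= k)%N] Xs) ->
  forall t : R, 0 < t ->
  (prophet_value Xs S t - stopping_value Xs S t <=
     (Num.min ((b - a) * beta t)
              (b * beta t * (1 - expR (- t)) /
                 (beta t + 1 - expR (- t))))%:E)%E.
Proof.
move=> a0 ab Xab Xsab indXs lawXs _ S_poisson indSX t t0.
have b0 : 0 < b by exact: le_lt_trans ab.
have Xs0b k w : (1 <= k)%N -> 0 <= Xs k w <= b.
  by move=> /(Xsab k w) /andP[/(le_trans a0)-> ->].
have p0 := one_sub_expRN_gt0 t0; have beta0 := beta_ge0 t0.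
have bound x (x0b : 0 <= x <= b) :=
  prophet_sub_stopping_le t0 x0b Xs0b indXs lawXs S_poisson indSX.
have bound_a := bound a.
(* This [x] solves [beta t / p * (b - x) = x] with [p = 1 - expR (- t)], so that [q] drops out of
   the bound. *)
have bound_x := bound (b * beta t / (beta t + (1 - expR (- t)))).
rewrite /= in bound_a bound_x.
rewrite [Num.min _ _]minElt; case: ifP => _.
  (* All values reach the threshold [a], so [g = 1] and [q = p]: the term [(p - q) * a]
     disappears. *)
  have Xa : X @^-1` `[a, +oo[ = setT.
    by rewrite -subTset => w _ /=; rewrite in_itv/= andbT; have /andP[] := Xab w.
  rewrite Xa probability_setT/= mulr1 subrr mul0r add0r in bound_a.
  apply: le_trans (bound_a _) _; first by rewrite a0 ltW.
  by rewrite lee_fin mulrC (mulrC (_ - _) (_ / _)) divfK ?gt_eqF.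
have s0 : 0 < beta t + (1 - expR (- t)) by rewrite ltr_wpDl.
apply: le_trans (bound_x _) _.
  rewrite divr_ge0 ?mulr_ge0 ?(ltW b0) ?(ltW s0)//=.
  by rewrite ler_pdivrMr// ler_pM2l// lerDl ltW.
rewrite -(addrA (beta t)) lee_fin le_eqVlt; apply/orP; left; apply/eqP.
set p := 1 - expR (- t) in p0 s0 *; set q := expR _.
by field; rewrite !gt_eqF.
Qed.
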